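(* Let $m, n, d \in \mathbb{N}$ with $0<d < \min\{m,n\}$, and let $c=m+n-2d-1$. Then $$q_0(m,n,d)=(-1)^{\binom{d}{2}} \prod_{i=1}^{d}\frac{(i-1)!\,(c+i-1)!}{(m-i-1)!\,(n-i)!},$$ and for $1\le j\le d$ the following identities hold in $\mathbb{Q}$: $$q_j(m,n,d)=\frac{\binom{d}{j}\binom{n-d+j-1}{j}}{\binom{m-1}{j}} \, q_0(m,n,d).$$
   Context: For $0<d<\min\{m,n\}$ and $c=m+n-2d-1$, let $H(m,n,d)$ be the $d\times(d+1)$ integer matrix $\left(\binom{c}{m-i-j}\right)_{1\le i\le d,\ 0\le j\le d}$, with rows indexed by $i$ and columns by $j$, where $\binom{c}{k}=0$ for $k<0$ and for $k>c$. For $0\le j\le d$, $q_j(m,n,d)\in\mathbb{Z}$ is the determinant of the $d\times d$ submatrix of $H(m,n,d)$ obtained by deleting its $(j+1)$-th column (that is, the column indexed by $j$). *)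

(* Defs.v *)
From mathcomp Require Import all_boot all_order all_algebra.

Set Implicit Arguments.
Unset Strict Implicit.
Unset Printing Implicit Defensive.

Import GRing.Theory.
Local Open Scope ring_scope.

(* Lower index in int, so that a negative k gives 0 rather than being
   truncated to k = 0 by the subtraction on nat. *)
Definition binz (c : nat) (k : int) : nat :=
  if k is Posz k' then 'C(c, k') else 0%N.

(* The subtraction is the truncated one, exact as soon as d < minn m n. *)
Definition cpar (m n d : nat) : nat := (m + n - 2 * d - 1)%N.

(* The row index i : 'I_d starts at 0, hence i.+1 for the 1-based index. *)
Definition H (m n d : nat) : 'M[int]_(d, d.+1) :=
  \matrix_(i < d, j < d.+1)
    (binz (cpar m n d) (m%:Z - (i.+1)%:Z - j%:Z))%:Z.

Definition q (m n d : nat) (j : 'I_d.+1) : int :=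
  \det (col' j (H m n d) : 'M[int]_d).

(* Main.v *)
Require Import Defs.
From mathcomp Require Import all_boot all_order all_algebra.
From mathcomp Require Import zify ring.

Import GRing.Theory Num.Theory.
Local Open Scope ring_scope.

(** Write [N = c + d - 1] and [a_j = m - 1 - j].  With rows counted from 0, the
    entry of [H] at [(i, j)] is [C(c, a_j - i)], and
<<
      C(c, a - i) = c! / (a! (N - a)!) * a^_i * (N - a)^_(d - 1 - i),
>>
    where both sides vanish together when [a < i] or [a - i > c]
    ([binz_falling]).  The first factor depends on the column only; the other
    two are the value at [a] of a polynomial of degree [d - 1] ([bipoly]).  A
    minor of [H] is thus a product of column weights times a determinant
    [det (P_i(a_j))] with all [P_i] of size at most [d], that is, a constant
    [K] times a Vandermonde determinant ([det_horner]).

    [K] does not depend on the nodes, so it can be computed at the nodes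
    [0, ..., d - 1], where the matrix is triangular because [k^_i = 0] for
    [k < i]; this gives [K = prod_i (c + i)! / c!] ([det_bipoly]).  The
    resulting closed form of an arbitrary minor is [det_binz].

    Deleting column [j] leaves the nodes [m - 1 - k] with [k <> j].  Up to the
    sign [(-1)^C(d, 2)] coming from their decreasing order, their Vandermonde
    product is that of [0, ..., d] divided by the factors that involve [j],
    namely [j! (d - j)!] ([Vandermonde_iota_lift]).  The column weights are
    likewise the full product over [0, ..., d] divided by the weight of [j].
    So [q_j] is a quantity independent of [j] times
    [(m - 1 - j)! (n - d - 1 + j)! / (j! (d - j)!)] ([q_formula]), and both
    claims follow by comparing factorials. *)

(** * Falling factorials and factorials *)

Lemma factr_neq0 n : (n`!)%:R != 0 :> rat.
Proof. by rewrite pnatr_eq0 -lt0n fact_gt0. Qed.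

Definition falling {R : nzRingType} (x : R) (k : nat) : R :=
  \prod_(l < k) (x - l%:R).

Lemma falling_nat (R : nzRingType) (a k : nat) :
  falling (a%:R : R) k = (a ^_ k)%:R.
Proof.
rewrite /falling; case: (leqP k a) => [le_ka|lt_ak].
  rewrite ffact_prod natr_prod; apply: eq_bigr => l _.
  by rewrite natrB // ltnW // (leq_trans (ltn_ord l)).
(* The factor of index [a] vanishes. *)
rewrite ffact_small //; elim: k lt_ak => // k IHk.
rewrite ltnS leq_eqVlt big_ord_recr /= => /predU1P[->|/IHk->].
  by rewrite subrr mulr0.
by rewrite mul0r.
Qed.

Lemma rmorph_falling (R S : nzRingType) (f : {rmorphism R -> S}) (x : R) k :
  f (falling x k) = falling (f x) k.
Proof.
by rewrite rmorph_prod; apply: eq_bigr => l _; rewrite rmorphB rmorph_nat.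
Qed.

Lemma size_falling (R : comNzRingType) (p : {poly R}) k :
  (size p <= 2)%N -> (size (falling p k) <= k.+1)%N.
Proof.
move=> sp; rewrite /falling; elim: k => [|k IHk].
  by rewrite big_ord0 size_poly1.
rewrite big_ord_recr /=; apply: leq_trans (size_polyMleq _ _) _.
have sq : (size (p - k%:R)%R <= 2)%N.
  apply: leq_trans (size_polyD _ _) _; rewrite geq_max sp size_polyN.
  by rewrite -polyC_natr (leq_trans (size_polyC_leq1 _)).
by move: (leq_add IHk sq); rewrite addn2; case: (_ + _)%N.
Qed.

(** * Vandermonde products *)

(** The matrix of values is the matrix of coefficients times the Vandermonde
    matrix of the nodes. *)
Lemma det_horner {R : comNzRingType} {d} (P : 'I_d -> {poly R}) (x : 'I_d -> R) :
  (forall i, size (P i) <= d)%N ->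
  \det (\matrix_(i, j) (P i).[x j]) =
  \det (\matrix_(i, k < d) (P i)`_k)
    * \prod_(i < d) \prod_(j < d | (i < j)%N) (x j - x i).
Proof.
move=> sP; pose a := \row_j x j.
have -> : \matrix_(i, j) (P i).[x j]
          = (\matrix_(i, k < d) (P i)`_k) *m Vandermonde d a.
  apply/matrixP=> i j; rewrite !mxE (horner_coef_wide _ (sP i)).
  by apply: eq_bigr => k _; rewrite !mxE.
rewrite det_mulmx det_Vandermonde; congr (_ * _).
by apply: eq_bigr => i _; apply: eq_bigr => j _; rewrite !mxE.
Qed.

(** Nodes differ from node 0 by [1, ..., d], which gives the top factorial; the
    other nodes are a translate of the previous case. *)
Lemma Vandermonde_iota d :
  \prod_(i < d) \prod_(j < d | (i < j)%N) (j%:R - i%:R) =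
  \prod_(i < d) (i`!)%:R :> rat.
Proof.
elim: d => [|d IHd]; first by rewrite !big_ord0.
rewrite big_ord_recl big_ord_recr /= mulrC -IHd; congr (_ * _).
  apply: eq_bigr => i _; rewrite big_mkcond big_ord_recl /= mul1r.
  rewrite [RHS]big_mkcond; apply: eq_bigr => j _.
  rewrite /bump /= !add1n ltnS; case: ifP => // _; rewrite -!natr1; ring.
rewrite big_mkcond big_ord_recl /= mul1r fact_prod big_add1 big_mkord natr_prod.
by apply: eq_bigr => j _; rewrite /bump /= ?add1n subr0.
Qed.

(** Among the pairs from [0, ..., d], those involving [k] contribute
    [(d - k)!] for the larger partners and [k!] for the smaller ones; the
    remaining pairs are indexed by the increasing map [lift k]. *)
Lemma Vandermonde_iota_lift d (k : 'I_d.+1) :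
  \prod_(i < d) \prod_(j < d | (i < j)%N) ((lift k j)%:R - (lift k i)%:R)
  = \prod_(i < d.+1) (i`!)%:R / ((k`!)%:R * ((d - k)`!)%:R) :> rat.
Proof.
apply: (canRL (mulfK _)); first by rewrite mulf_neq0 ?factr_neq0.
rewrite -Vandermonde_iota (bigD1_ord k) //=.
have -> : \prod_(i < d) \prod_(j < d.+1 | (lift k i < j)%N)
             (j%:R - (lift k i)%:R)
   = (\prod_(i < d | (lift k i < k)%N) (k%:R - (lift k i)%:R)) *
     \prod_(i < d) \prod_(j < d | (i < j)%N) ((lift k j)%:R - (lift k i)%:R)
   :> rat.
  rewrite [X in X * _]big_mkcond -big_split; apply: eq_bigr => i _ /=.
  rewrite big_mkcond (bigD1_ord k) //=; congr (_ * _).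
  rewrite [RHS]big_mkcond; apply: eq_bigr => j _.
  by have -> : (bump k i < bump k j)%N = (i < j)%N by rewrite /bump; lia.
have -> : \prod_(j < d.+1 | (k < j)%N) (j%:R - k%:R) = ((d - k)`!)%:R :> rat.
  rewrite fact_prod natr_prod.
  rewrite -(big_mkord (fun j => (k < j)%N) (fun j => j%:R - k%:R)).
  have hk := ltn_ord k.
  rewrite (big_cat_nat (n := k.+1)) //= big_nat_cond big_pred0 ?mul1r; last first.
    by move=> j; lia.
  rewrite -{1}[k.+1]add1n big_addn; have -> : (d.+1 - k = (d - k).+1)%N by lia.
  rewrite big_nat_cond [RHS]big_nat_cond.
  apply: eq_big => [j|j _]; first by lia.
  by rewrite natrD addrK.
have -> : \prod_(i < d | (lift k i < k)%N) (k%:R - (lift k i)%:R) = (k`!)%:R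
   :> rat.
  have hk := ltn_ord k.
  transitivity (\prod_(0 <= i < d | (i < k)%N) (k%:R - i%:R) : rat).
    rewrite big_mkord; apply: eq_big => [i|i]; rewrite /= /bump; first by lia.
    by move=> ?; congr (_ - _%:R); lia.
  rewrite (big_cat_nat (n := k)) //= [X in _ * X]big_nat_cond.
  rewrite [X in _ * X]big_pred0 ?mulr1; last by move=> j; lia.
  rewrite -ffactnn -falling_nat /falling -(big_mkord predT (fun i => k%:R - i%:R)).
  by rewrite big_nat_cond [RHS]big_nat_cond; apply: eq_bigl => j /=; lia.
by rewrite /=; ring.
Qed.

Lemma sign_Vandermonde {R : comNzRingType} d (x : 'I_d -> R) :
  \prod_(i < d) \prod_(j < d | (i < j)%N) (- x j - - x i)
  = (-1) ^+ 'C(d, 2) * \prod_(i < d) \prod_(j < d | (i < j)%N) (x j - x i).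
Proof.
have -> : (-1) ^+ 'C(d, 2)
   = \prod_(i < d) \prod_(j < d | (i < j)%N) (-1) :> R.
  elim: d {x} => [|d IHd]; first by rewrite big_ord0.
  rewrite binS bin1 exprD IHd big_ord_recl mulrC; congr (_ * _).
    by rewrite big_mkcond big_ord_recl /= mul1r prodr_const card_ord.
  apply: eq_bigr => i _; rewrite [RHS]big_mkcond big_ord_recl /= mul1r.
  by rewrite big_mkcond.
rewrite -big_split; apply: eq_bigr => i _; rewrite -big_split.
by apply: eq_bigr => j _ /=; ring.
Qed.

(** * Minors of matrices of binomial coefficients *)

(** The polynomial part of [C(c, a - i)] as a function of [a], where
    [N = c + d - 1]: it interpolates [a^_i * (N - a)^_(d - 1 - i)]. *)
Definition bipoly (d N i : nat) : {poly rat} :=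
  falling 'X i * falling (N%:R%:P - 'X) (d.-1 - i).

Lemma size_bipoly d N (i : 'I_d) : (size (bipoly d N i) <= d)%N.
Proof.
apply: leq_trans (size_polyMleq _ _) _.
have s1 : (size (falling ('X : {poly rat}) i) <= i.+1)%N.
  by apply: size_falling; rewrite size_polyX.
have s2 : (size (falling (N%:R%:P - 'X : {poly rat}) (d.-1 - i))
           <= (d.-1 - i).+1)%N.
  apply: size_falling; apply: leq_trans (size_polyD _ _) _.
  by rewrite size_polyN size_polyX geq_max (leq_trans (size_polyC_leq1 _)).
move: (leq_add s1 s2); rewrite addSn addnS; set u := (_ + _)%N.
by have := ltn_ord i; lia.
Qed.

Lemma horner_bipoly d N i a : (a <= N)%N ->
  (bipoly d N i).[a%:R] = (a ^_ i * (N - a) ^_ (d.-1 - i))%:R.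
Proof.
move=> le_aN; rewrite -horner_evalE rmorphM /= !rmorph_falling /= !horner_evalE.
by rewrite !hornerE -natrB // !falling_nat natrM.
Qed.

(** By [det_horner] only the determinant of the coefficient matrix is needed; it
    is read off from the nodes [0, ..., d - 1], where the diagonal entries are
    [i! * (N - i)! / c!] and their factors [i!] cancel the Vandermonde product. *)
Lemma det_bipoly c d N (x : 'I_d -> rat) : (c + d = N.+1)%N ->
  \det (\matrix_(i, j) (bipoly d N i).[x j])
  = \prod_(i < d) (((c + i)`!)%:R / (c`!)%:R)
    * \prod_(i < d) \prod_(j < d | (i < j)%N) (x j - x i).
Proof.
move=> eN; have szB := size_bipoly d N.
rewrite (det_horner _ x szB); congr (_ * _).
have := det_horner _ (fun j => j%:R) szB.
rewrite Vandermonde_iota => E.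
have nzV : \prod_(i < d) (i`!)%:R != 0 :> rat by apply/prodf_neq0 => i _; apply: factr_neq0.
(* [P_i(k) = 0] for [k < i]. *)
apply: (mulIf nzV); rewrite -{}E -det_tr det_trig; last first.
  apply/is_trig_mxP => i j lt_ij; rewrite !mxE horner_bipoly; last first.
    by have := ltn_ord i; have := ltn_ord j; lia.
  by rewrite ffact_small.
rewrite [\prod_(i < d) ((c + i)`!%:R / _)](reindex_inj rev_ord_inj).
rewrite -big_split; apply: eq_bigr => i _ /=; rewrite !mxE.
have lt_id := ltn_ord i; rewrite horner_bipoly; last by lia.
rewrite ffactnn natrM [RHS]mulrC; congr (_ * _).
apply: (canRL (mulfK (factr_neq0 c))); rewrite -natrM; congr (_%:R).
have -> : (c + (d - i.+1) = N - i)%N by lia.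
rewrite -(@ffact_fact (N - i) (d.-1 - i)); last by lia.
by congr (_ * _`!)%N; lia.
Qed.

(** The bound [a <= N] makes the right-hand side vanish through the second
    falling factorial exactly when [a - i] exceeds [c]. *)
Lemma binz_falling c d N a i : (c + d = N.+1)%N -> (i < d)%N -> (a <= N)%N ->
  (binz c (a%:Z - i%:Z) * (a`! * (N - a)`!)
   = a ^_ i * (N - a) ^_ (d.-1 - i) * c`!)%N.
Proof.
move=> eN lt_id le_aN; case: (ltnP a i) => [lt_ai|le_ia].
  rewrite [a ^_ i]ffact_small // !mul0n.
  have -> : a%:Z - i%:Z = Negz (i - a).-1 by lia.
  by rewrite mul0n.
rewrite subzn //=; case: (ltnP c (a - i)) => [lt_c|le_c].
  by rewrite bin_small // [(N - a) ^_ _]ffact_small ?muln0 ?mul0n //; lia.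
rewrite -(bin_fact le_c) -(ffact_fact le_ia).
rewrite -(@ffact_fact (N - a) (d.-1 - i)); last by lia.
have -> : (N - a - (d.-1 - i) = c - (a - i))%N by lia.
by ring.
Qed.

(** Column [j] of the matrix is [c! / (a_j! (N - a_j)!)] times the values of the
    [bipoly]s at [a_j]; the [d] factors [c!] cancel those of [det_bipoly]. *)
Lemma det_binz c d N (a : 'I_d -> nat) :
  (c + d = N.+1)%N -> (forall j, a j <= N)%N ->
  ((\det (\matrix_(i, j < d) (binz c ((a j)%:Z - i%:Z))%:Z))%:~R : rat)
  = \prod_(i < d) ((c + i)`!)%:R
    / \prod_(j < d) (((a j)`!)%:R * ((N - a j)`!)%:R)
    * \prod_(i < d) \prod_(j < d | (i < j)%N) ((a j)%:R - (a i)%:R).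
Proof.
move=> eN le_aN.
rewrite -(det_map_mx intr).
pose w := \row_(j < d) ((c`!)%:R / (((a j)`!)%:R * ((N - a j)`!)%:R) : rat).
have -> : map_mx intr (\matrix_(i, j < d) (binz c ((a j)%:Z - i%:Z))%:Z)
   = \matrix_(i, j) (bipoly d N i).[(a j)%:R] *m diag_mx w.
  rewrite mul_mx_diag; apply/matrixP=> i j; rewrite !mxE horner_bipoly //.
  rewrite mulrA; apply: (canRL (mulfK _)); first by rewrite mulf_neq0 ?factr_neq0.
  by rewrite -pmulrn -!natrM (@binz_falling c d).
rewrite det_mulmx (@det_bipoly c) // det_diag mulrAC; congr (_ * _).
rewrite -prodf_div -big_split /=.
apply: eq_bigr => i _; rewrite mxE.
by field; rewrite !factr_neq0.
Qed.

(** * The minors of H *)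

(** The inverse of the factor that column [k] contributes to a minor: the
    product [a! (N - a)!] at [a = m - 1 - k], for [N = m + n - d - 2]. *)
Definition weight (m n d k : nat) : rat :=
  ((m - 1 - k)`!)%:R * ((n - d - 1 + k)`!)%:R.

Lemma weight_neq0 m n d k : weight m n d k != 0.
Proof. by rewrite mulf_neq0 ?factr_neq0. Qed.

(** Products over the columns other than [j] are written as full products
    divided by the contribution of [j], so that everything outside the last
    factor is the same for all [j]. *)
Lemma q_formula m n d (j : 'I_d.+1) : (d < minn m n)%N ->
  ((q m n j)%:~R : rat)
  = (-1) ^+ 'C(d, 2)
    * (\prod_(i < d) ((cpar m n d + i)`!)%:R
       / \prod_(k < d.+1) weight m n d k * \prod_(i < d.+1) (i`!)%:R)
    * (weight m n d j / ((j`!)%:R * ((d - j)`!)%:R)).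
Proof.
rewrite leq_min => /andP[lt_dm lt_dn].
have le_lift k : (lift j k <= d)%N by rewrite -ltnS ltn_ord.
pose a (k : 'I_d) := (m - 1 - lift j k)%N; pose N := (m + n - d - 2)%N.
have -> : q m n j = \det (\matrix_(i, k < d)
                      (binz (cpar m n d) ((a k)%:Z - i%:Z))%:Z).
  congr (\det _); apply/matrixP=> i k; rewrite !mxE.
  by congr ((binz _ _)%:Z); have := le_lift k; rewrite /a; lia.
rewrite (@det_binz _ d N) /cpar; first last.
- by move=> k; rewrite /a /N; lia.
- by rewrite /N; lia.
have -> : \prod_(k < d) (((a k)`!)%:R * ((N - a k)`!)%:R)
  = \prod_(k < d.+1) weight m n d k / weight m n d j :> rat.
  rewrite (bigD1_ord j) //= mulrAC mulfV ?weight_neq0 // mul1r.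
  apply: eq_bigr => k _; congr (_ * (_`!)%:R).
  by have := le_lift k; rewrite /a /N /=; lia.
have -> : \prod_(i < d) \prod_(k < d | (i < k)%N) ((a k)%:R - (a i)%:R)
  = (-1) ^+ 'C(d, 2)
    * (\prod_(i < d.+1) (i`!)%:R / ((j`!)%:R * ((d - j)`!)%:R)) :> rat.
  rewrite -Vandermonde_iota_lift -sign_Vandermonde.
  apply: eq_bigr => i _; apply: eq_bigr => k _.
  have := le_lift k; have := le_lift i; rewrite /a /= => hi hk.
  by rewrite !natrB; [ring| | | |]; lia.
by rewrite invf_div; ring.
Qed.

Theorem theorem1p2 (m n d : nat) (hd : (0 < d < minn m n)%N) :
  let c := cpar m n d in
  ((q m n (ord0 : 'I_d.+1))%:~R : rat) =
    (-1) ^+ 'C(d, 2) *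
    \prod_(1 <= i < d.+1)
      (((i - 1)`!)%:R * ((c + i - 1)`!)%:R
        / (((m - i - 1)`!)%:R * ((n - i)`!)%:R))
  /\
  forall j : 'I_d.+1, (1 <= j <= d)%N ->
    ((q m n j)%:~R : rat) =
      ('C(d, j))%:R * ('C(n - d + j - 1, j))%:R / ('C(m - 1, j))%:R
      * (q m n (ord0 : 'I_d.+1))%:~R.
Proof.
move=> c; case/andP: hd => d_gt0 lt_d.
split=> [|j /andP[j_gt0 le_jd]]; rewrite !(q_formula _ _ _ _ lt_d) -?/c.
  rewrite -mulrA; congr (_ * _); rewrite fact0 mul1r subn0.
  have -> : \prod_(1 <= i < d.+1)
              (((i - 1)`!)%:R * ((c + i - 1)`!)%:R
                / (((m - i - 1)`!)%:R * ((n - i)`!)%:R))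
     = \prod_(i < d) (i`!)%:R * \prod_(i < d) ((c + i)`!)%:R
       / \prod_(k < d) weight m n d k.+1 :> rat.
    rewrite big_add1 big_mkord prodf_div !big_split /=.
    congr (_ * _ / (_ * _)); last rewrite [LHS](reindex_inj rev_ord_inj) /=.
    - by apply: eq_bigr => i _; rewrite subn1.
    - by apply: eq_bigr => i _; rewrite addnS subn1.
    - by apply: eq_bigr => i _; rewrite subnAC.
    by apply: eq_bigr => i _; have := ltn_ord i => ?; congr (_`!%:R); lia.
  rewrite big_ord_recl [\prod_(i < d.+1) _]big_ord_recr /=.
  have nzW : \prod_(k < d) weight m n d k.+1 != 0.
    by apply/prodf_neq0 => k _; apply: weight_neq0.
  have nz0 := weight_neq0 m n d 0.
  by field; rewrite nzW nz0 factr_neq0.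
(* Both sides are [K] times a quotient of factorials. *)
set K := _ * (_ * _); rewrite mulrCA; congr (_ * _).
rewrite fact0 mul1r subn0.
have bin_frac a b : (b <= a)%N ->
    ('C(a, b))%:R = (a`!)%:R / ((b`!)%:R * ((a - b)`!)%:R) :> rat.
  move=> le_ba; apply: (canRL (mulfK _)); first by rewrite mulf_neq0 ?factr_neq0.
  by rewrite -!natrM bin_fact.
rewrite !bin_frac; [|lia..].
rewrite /weight subn0 addn0.
have -> : (n - d + j - 1 - j = n - d - 1)%N by lia.
have -> : (n - d + j - 1 = n - d - 1 + j)%N by lia.
by field; rewrite !factr_neq0.
Qed.
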